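(* Let $A$ and $B$ be finite sets in a group and let $\alpha,\beta,\gamma>0$. Suppose that (1) $|AB|\leq\alpha|A|$; (2) $|AbB|\leq\beta|A|$ for all $b\in B$; (3) $|A|\leq\gamma|B|$. Then there exists $S\subseteq A$ such that for every integer $h>1$, $$|SB^h|\leq \alpha^{8h-9}\beta^{h-1}\gamma^{4h-5}|S|.$$
   Context: For subsets $U,V$ of a group, $UV=\{uv:u\in U,v\in V\}$; $AbB=\{a b b': a\in A, b'\in B\}$; $B^h$ denotes the $h$-fold product set $B\cdots B$ ($h$ factors), and $SB^h=\{sx: s\in S, x\in B^h\}$. *)

(* Defs.v *)
From HB Require Import structures.
From mathcomp Require Import all_boot all_order all_algebra finmap.
From mathcomp Require Import reals.

Set Implicit Arguments.
Unset Strict Implicit.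
Unset Printing Implicit Defensive.

Import Order.TTheory GRing.Theory Num.Theory.

Local Open Scope fset_scope.

(* [groupType] is not assumed finite or commutative. *)
Definition mulfs (G : groupType) (U V : {fset G}) : {fset G} :=
  [fset (u * v)%g | u in U, v in V].

(* B^h, with the convention B^0 = {1}. *)
Definition expfs (G : groupType) (B : {fset G}) (h : nat) : {fset G} :=
  iter h (mulfs B) [fset 1%g].

(* Main.v *)
(** One may take S = A.  A greedy choice of translates A b gives k >= 1 and a set
    T of at most k elements of B such that every A b with b in B meets A T in at
    least k |A| / alpha^2 points.  Counting factorizations
    s b b' = (s a1^-1) (a2 a^-1) (a t b'), one for each a in A and each common
    point a1 b = a2 t of A b and A T, bounds |A B B| in terms of
    max_b |A b B| and |A A^-1|; the factor k cancels.  The Ruzsa triangle inequality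
    controls |A A^-1|, then |B^-1 B B|, and then the ratios
    |A B^(h+1)| / |A B^h|. *)

Require Import Defs.
From HB Require Import structures.
From mathcomp Require Import all_boot all_order all_algebra finmap.
From mathcomp Require Import reals ring lra zify.

Set Implicit Arguments.
Unset Strict Implicit.
Unset Printing Implicit Defensive.

Import Order.TTheory GRing.Theory Num.Theory.

Local Open Scope fset_scope.

(** * Counting by explicit injections and by fibres *)

Section FsetCard.
Variables K V : choiceType.

(** A left inverse on [D] makes [f] injective there. Both injections used below come with an
    explicit decoding map [g]. *)
Lemma leq_card_fset_can (D : {fset K}) (E : {fset V}) (f : K -> V) (g : V -> K) :
  {in D, forall x, f x \in E} -> {in D, cancel f g} -> (#|` D| <= #|` E|)%N.
Proof.
move=> fE fK; rewrite -(eqP (introT (card_in_imfsetP f D) (can_in_inj fK))).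
by apply/fsubset_leq_card/fsubsetP => _ /imfsetP[x xD ->]; apply: fE.
Qed.

Definition fset_sigma (X : {fset K}) (F : K -> {fset V}) : {fset K * V} :=
  [fset ((x, y) : K * V) | x in X, y in F x].

Lemma in_fset_sigma X F (p : K * V) :
  (p \in fset_sigma X F) = (p.1 \in X) && (p.2 \in F p.1).
Proof.
case: p => x y; apply/imfset2P/andP => /= [[x' xX [y' yF [-> ->]]] //|[xX yF]].
by exists x => //; exists y.
Qed.

Lemma card_fset_sigma X F :
  #|` fset_sigma X F| = (\sum_(x <- X) #|` F x|)%N.
Proof.
rewrite card_fset_sum1 big_imfset2 /=; last by move=> [? ?] [? ?] _ _ /= [-> ->].
by apply: eq_bigr => x _; rewrite -card_fset_sum1.
Qed.

End FsetCard.

Lemma card_fsetM (K V : choiceType) (X : {fset K}) (Y : {fset V}) :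
  #|` X `*` Y| = (#|` X| * #|` Y|)%N.
Proof.
have -> : X `*` Y = fset_sigma X (fun=> Y).
  by apply/fsetP => p; rewrite [LHS]in_fsetM [RHS]in_fset_sigma.
by rewrite card_fset_sigma big_const_seq count_predT iter_addn_0 mulnC.
Qed.

(** * Product sets and the Ruzsa triangle inequality *)

Section ProductSets.
Variable G : groupType.
Implicit Types (B T X Y Z : {fset G}) (b x y z : G).

Definition invfs X : {fset G} := [fset (x^-1)%g | x in X].

Lemma mulfsP X Y z :
  reflect (exists2 x, x \in X & exists2 y, y \in Y & z = (x * y)%g)
          (z \in mulfs X Y).
Proof.
apply: (iffP idP) => [/imfset2P[/= x xX [y yY ->]]|[x xX [y yY ->]]].
  by exists x => //; exists y.
by apply/imfset2P; exists x => //; exists y.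
Qed.

Lemma mem_mulfs X Y x y :
  x \in X -> y \in Y -> (x * y)%g \in mulfs X Y.
Proof. by move=> xX yY; apply/mulfsP; exists x => //; exists y. Qed.

Lemma mem_invfs X x : ((x^-1)%g \in invfs X) = (x \in X).
Proof.
apply/imfsetP/idP => /= [[y yX /(can_inj (@invgK G)) ->]//|xX].
by exists x.
Qed.

Lemma invfsK : involutive invfs.
Proof.
by move=> X; apply/fsetP => x; rewrite -[x]invgK !mem_invfs invgK.
Qed.

Lemma card_invfs X : #|` invfs X| = #|` X|.
Proof. by apply/eqP/card_in_imfsetP => x y _ _ /invg_inj. Qed.

Lemma invfs_mul X Y : invfs (mulfs X Y) = mulfs (invfs Y) (invfs X).
Proof.
apply/fsetP => z; rewrite -[z]invgK mem_invfs.
apply/mulfsP/mulfsP => [[x xX [y yY ->]]|].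
  by exists (y^-1)%g; rewrite ?mem_invfs //; exists (x^-1)%g;
    rewrite ?mem_invfs // invgM.
move=> [y yY [x xX e]]; exists (x^-1)%g; first by rewrite -mem_invfs invgK.
exists (y^-1)%g; first by rewrite -mem_invfs invgK.
by rewrite -invgM -e invgK.
Qed.

Lemma mulfsA X Y Z : mulfs X (mulfs Y Z) = mulfs (mulfs X Y) Z.
Proof.
apply/fsetP => w; apply/mulfsP/mulfsP.
  move=> [x xX [_ /mulfsP[y yY [z zZ ->]] ->]].
  by exists (x * y)%g; [exact: mem_mulfs|exists z => //; rewrite mulgA].
move=> [_ /mulfsP[x xX [y yY ->]] [z zZ ->]].
by exists x => //; exists (y * z)%g; [exact: mem_mulfs|rewrite mulgA].
Qed.

Lemma mulfsS X X' Y Y' : X `<=` X' -> Y `<=` Y' -> mulfs X Y `<=` mulfs X' Y'.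
Proof.
move=> /fsubsetP sX /fsubsetP sY; apply/fsubsetP => _ /mulfsP[x xX [y yY ->]].
by apply: mem_mulfs; [exact: sX|exact: sY].
Qed.

Lemma mulfsU1 X b T : mulfs X (b |` T) = mulfs X [fset b] `|` mulfs X T.
Proof.
apply/fsetP => z; rewrite in_fsetU; apply/mulfsP/orP.
  move=> [x xX [y]]; rewrite in_fset1U => /orP[/eqP-> ->|yT ->].
    by left; apply: mem_mulfs; rewrite ?inE.
  by right; apply: mem_mulfs.
move=> [] /mulfsP[x xX [y yT ->]]; exists x => //; exists y => //;
  by rewrite in_fset1U; move: yT; rewrite ?inE => ->; rewrite ?orbT.
Qed.

Lemma card_mulfs1 X b : #|` mulfs X [fset b]| = #|` X|.
Proof.
pose f x := (x * b)%g.
have /card_in_imfsetP/eqP <- : {in X &, injective f} by move=> x y _ _ /mulIg.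
congr #|` _|; apply/fsetP => z; apply/mulfsP/imfsetP => /=.
  by move=> [x xX [y /fset1P-> ->]]; exists x.
by move=> [x xX ->]; exists x => //; exists b => //; rewrite in_fset1.
Qed.

Lemma mulf1s X : mulfs X [fset 1%g] = X.
Proof.
apply/fsetP => z; apply/mulfsP/idP => [[x xX [y /fset1P-> ->]]|zX].
  by rewrite mulg1.
by exists z => //; exists 1%g; rewrite ?in_fset1 ?mulg1.
Qed.

Lemma expfs2 B : expfs B 2 = mulfs B B.
Proof. by rewrite /expfs /= mulf1s. Qed.

(** [expfs] adds factors on the left, while the growth argument for A B^h appends them on the
    right. *)
Lemma expfsSr B h : expfs B h.+1 = mulfs (expfs B h) B.
Proof.
elim: h => [|h IH].
  rewrite /expfs /= mulf1s; apply/fsetP => z; apply/idP/mulfsP => [zB|].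
    by exists 1%g; [rewrite in_fset1|exists z; rewrite ?mul1g].
  by move=> [x /fset1P-> [y yB ->]]; rewrite mul1g.
by rewrite -[RHS]/(mulfs (mulfs B (expfs B h)) B) -mulfsA -IH.
Qed.

(** Fixing one factorization per product lets the counting maps be functions of the product
    alone. *)
Lemma mulfs_section X Y : exists f : G -> G * G,
  forall z, z \in mulfs X Y ->
    [/\ (f z).1 \in X, (f z).2 \in Y & ((f z).1 * (f z).2)%g = z].
Proof.
(* The default pair is returned only for [z] outside [mulfs X Y]. *)
pose f z := head (1%g, 1%g) [seq p <- X `*` Y | (p.1 * p.2)%g == z].
exists f => z /mulfsP[x xX [y yY e]].
have: (x, y) \in [seq p <- X `*` Y | (p.1 * p.2)%g == z].
  by rewrite mem_filter /= e eqxx in_fsetM xX.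
rewrite /f; case E: [seq _ <- _ | _] => [//|q s] _ /=.
have: q \in [seq p <- X `*` Y | (p.1 * p.2)%g == z] by rewrite E mem_head.
by rewrite mem_filter in_fsetM => /andP[/eqP -> /andP[-> ->]].
Qed.

(** With w = x z the fixed factorization, (w, y) is sent to (x y^-1, y z). The product of the two
    coordinates is w, hence gives back x, and then y = (x y^-1)^-1 x. *)
Lemma ruzsa_triangle X Y Z :
  (#|` mulfs X Z| * #|` Y| <= #|` mulfs X (invfs Y)| * #|` mulfs Y Z|)%N.
Proof.
have [f fP] := mulfs_section X Z; rewrite -!card_fsetM.
apply: (@leq_card_fset_can _ _ _ _
  (fun p => ((f p.1).1 * p.2^-1, p.2 * (f p.1).2)%g)
  (fun q => let w := (q.1 * q.2)%g in (w, q.1^-1 * (f w).1)%g)).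
  move=> [w y]; rewrite !in_fsetM /= => /andP[/fP[xX zZ _] yY].
  by rewrite !mem_mulfs ?mem_invfs.
move=> [w y]; rewrite in_fsetM /= => /andP[/fP[_ _ e] _].
by rewrite mulgA mulgVK e invgM invgK mulgVK.
Qed.

End ProductSets.

Local Open Scope ring_scope.

(** * Greedy choice of translates *)

Section Covering.
Variables (R : realType) (G : groupType) (A B : {fset G}) (alpha : R).
Hypothesis hAB : #|` mulfs A B|%:R <= alpha * #|` A|%:R.

Let n : R := #|` A|%:R.
Let L : R := alpha ^+ 2.

(** The bound |A b [&] A T| >= k |A| / alpha^2, cleared of division. [k] is separate from |T|, of
    which only the bound |T| <= k is tracked. *)
Definition coversfs (k : nat) (T : {fset G}) := all (fun b =>
  k%:R * #|` A|%:R <= alpha ^+ 2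
    * #|` mulfs A [fset b] `&` mulfs A T|%:R) B.

Lemma card_mulfsU1 (b : G) (T : {fset G}) :
  #|` mulfs A (b |` T)|%:R =
    n + #|` mulfs A T|%:R - #|` mulfs A [fset b] `&` mulfs A T|%:R.
Proof.
by rewrite mulfsU1 /n -(card_mulfs1 A b) -natrD -cardfsUI natrD addrK.
Qed.

(* While no T of size at most k covers, adding a badly covered translate gains
   more than (1 - k / alpha ^ 2) |A| new elements. *)
Lemma coversfs_or_grow (k : nat) : B != fset0 ->
  (exists k T, [/\ (0 < k)%N, T `<=` B, (#|` T| <= k)%N & coversfs k T]) \/
  (exists T, [/\ T `<=` B, (#|` T| <= k.+1)%N &
    n * k.+1%:R * (2 * L - k%:R) <= 2 * L * #|` mulfs A T|%:R]).
Proof.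
move=> /fset0Pn[b0 b0B]; elim: k => [|k [|[T [TB Tk hT]]]]; [|by left|].
  right; exists [fset b0]; rewrite fsub1set b0B cardfs1 card_mulfs1; split=> //.
  by rewrite subr0 mulr1 mulrC.
have [cov|/allPn[b bB]] := boolP (coversfs k.+1 T).
  by left; exists k.+1, T.
rewrite -ltNge => hb; right; exists (b |` T).
rewrite cardfsU1 fsubUset fsub1set bB TB; split=> //.
  by rewrite -add1n leq_add // leq_b1.
(* The lower bound in the statement is 2 L times the sum of the gains n (1 - j / L) for 0 <= j <= k;
   this step adds the term j = k + 1. *)
rewrite card_mulfsU1; move: hb hT; rewrite -/L -/n -[k.+2%:R]natr1 -[k.+1%:R]natr1.
move: (#|` mulfs A T|%:R : R) (#|` _ `&` _|%:R : R) => x y hb hT.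
nra.
Qed.

Lemma exists_coversfs : A != fset0 -> B != fset0 ->
  exists k T, [/\ (0 < k)%N, T `<=` B, (#|` T| <= k)%N & coversfs k T].
Proof.
move=> A0 B0; have n_gt0 : 0 < n by rewrite ltr0n cardfs_gt0.
have sub T : T `<=` B -> #|` mulfs A T|%:R <= alpha * n.
  move=> TB; apply: le_trans hAB; rewrite ler_nat.
  exact/fsubset_leq_card/mulfsS.
have alpha_ge1 : 1 <= alpha.
  case/fset0Pn: B0 => b bB; have := sub [fset b].
  rewrite fsub1set bB card_mulfs1 -/n => /(_ isT) h.
  by rewrite -(ler_pM2r n_gt0) mul1r.
have L_ge1 : 1 <= L by rewrite exprn_ege1.
(* The greedy process runs up to size k + 1, the integer part of L; one more badly covered translate
   would push |A T| beyond alpha n. *)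
have /andP[K_le K_gt] := truncn_itv (le_trans ler01 L_ge1).
have := L_ge1; rewrite -truncn_gt0; move: K_le K_gt.
case: (Num.trunc L) => // k K_le K_gt _.
have [//|[T [TB Tk hT]]] := coversfs_or_grow k B0.
have [cov|/allPn[b bB]] := boolP (coversfs k.+1 T).
  by exists k.+1, T.
rewrite -ltNge => hb; exfalso.
have := sub (b |` T); rewrite fsubUset fsub1set bB TB => /(_ isT).
rewrite card_mulfsU1; move: hb hT K_le K_gt.
rewrite -/L -/n -[k.+2%:R]natr1 -[k.+1%:R]natr1.
move: (#|` mulfs A T|%:R : R) (#|` _ `&` _|%:R : R) (k%:R : R) => x y r.
move=> hb hT K_le K_gt hx.
have grow : n * (r + 2) * (2 * L - r - 1) < n * (2 * L * alpha) by nra.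
rewrite -mulrA ltr_pM2l // in grow.
(* For K = r + 1, K <= L < K + 1 gives (K + 1) (2 L - K) >= L (L + 1), so [grow] yields L + 1 < 2
   alpha, against (alpha - 1)^2 >= 0. *)
have LE : L = alpha * alpha by rewrite /L expr2.
have := sqr_ge0 (alpha - 1); nra.
Qed.

End Covering.

(** * Counting factorizations of the elements of A B B *)

Lemma card_mulfs_cover (R : realType) (G : groupType) (A B T : {fset G})
    (alpha beta : R) (k : nat) :
  (0 < k)%N -> T `<=` B -> (#|` T| <= k)%N -> coversfs A B alpha k T ->
  0 <= beta ->
  (forall b : G, b \in B ->
     #|` mulfs (mulfs A [fset b]) B|%:R <= beta * #|` A|%:R) ->
  A != fset0 ->
  #|` mulfs A (mulfs B B)|%:R * #|` A|%:R
    <= alpha ^+ 2 * beta * #|` mulfs A (invfs A)|%:R ^+ 2.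
Proof.
move=> k_gt0 /fsubsetP TB Tk /allP cov beta_ge0 hAbB A0.
have n_gt0 : 0 < #|` A|%:R :> R by rewrite ltr0n cardfs_gt0.
have [f fP] := mulfs_section A (mulfs B B).
have [g gP] := mulfs_section B B.
have [h hP] := mulfs_section A T.
pose b z := (g (f z).2).1; pose b' z := (g (f z).2).2.
have zE z : z \in mulfs A (mulfs B B) ->
    [/\ (f z).1 \in A, b z \in B, b' z \in B & ((f z).1 * (b z * b' z))%g = z].
  by move=> /fP[? /gP[? ? e] e']; split=> //; rewrite e.
pose P z := mulfs A [fset b z] `&` mulfs A T.
pose D := fset_sigma (mulfs A (mulfs B B)) (fun z => P z `*` A).
pose Q := mulfs A (invfs A).
pose E := fset_sigma T (fun t => mulfs (mulfs A [fset t]) B `*` (Q `*` Q)).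
(* With z = s b b', p = a1 b = a2 t, the factorization
   z = (s a1^-1) (a2 a^-1) (a t b') has at most |T| beta |A| |A A^-1|^2
   possible values, and it determines z, p and a. *)
have DE : (#|` D| <= #|` E|)%N.
  apply: (@leq_card_fset_can _ _ _ _
    (fun q => let z := q.1 in let p := q.2.1 in let a := q.2.2 in
       ((h p).2, ((a * (h p).2) * b' z,
         ((f z).1 * (p * (b z)^-1)^-1, (h p).1 * a^-1)))%g)
    (* Decoding: z is the product of the three factors, which fixes s and b; then p = u^-1 s b, and
       p fixes a2, so a = v^-1 a2. *)
    (fun q => let u := q.2.2.1 in let v := q.2.2.2 in
       let z := (u * v * q.2.1)%g in
       let p := (u^-1 * (f z).1 * b z)%g in (z, (p, v^-1 * (h p).1)))%g).
    move=> [z [p a]]; rewrite !in_fset_sigma /=.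
    move=> /andP[/zE[sA bB b'B e] /andP[]]; rewrite in_fsetI => /andP[].
    move=> /mulfsP[a1 a1A [y /fset1P-> ep]] /hP[a2A tT e2] aA.
    rewrite tT !mem_mulfs ?mem_invfs ?in_fset1 //.
    by rewrite ep mulgK.
  move=> [z [p a]]; rewrite !in_fset_sigma /=.
  move=> /andP[/zE[sA bB b'B e] /andP[]]; rewrite in_fsetI => /andP[].
  move=> /mulfsP[a1 a1A [y /fset1P-> ep]] /hP[a2A tT e2] aA.
  set w := (_ * _ * (_ * _ * _))%g; have -> : w = z.
    have -> : w = ((f z).1 * b z * p^-1 * ((h p).1 * (h p).2) * b' z)%g.
      by rewrite /w invgM invgK !mulgA mulgVK.
    by rewrite e2 mulgVK -mulgA.
  by rewrite !invgM !invgK mulgVK mulgVK mulgVK.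
(* Each z has |P z| |A| pairs (p, a) above it, and the covering property bounds |P z| from below by
   k |A| / alpha^2. *)
have lo : #|` mulfs A (mulfs B B)|%:R * (k%:R * #|` A|%:R * #|` A|%:R)
    <= alpha ^+ 2 * #|` D|%:R :> R.
  rewrite card_fset_sigma natr_sum mulr_sumr mulr_natl -iter_addr_0.
  rewrite -(count_predT (mulfs A (mulfs B B))) -big_const_seq.
  rewrite big_seq [X in _ <= X]big_seq; apply: ler_sum => z /zE[_ bB _ _].
  by rewrite card_fsetM natrM mulrA ler_pM2r // cov.
have hi : #|` E|%:R <= k%:R * (beta * #|` A|%:R * #|` Q|%:R ^+ 2) :> R.
  rewrite card_fset_sigma natr_sum.
  apply: (@le_trans _ _ (\sum_(t <- T) (beta * #|` A|%:R * #|` Q|%:R ^+ 2))).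
    rewrite big_seq [X in _ <= X]big_seq; apply: ler_sum => t /TB tB.
    by rewrite !card_fsetM !natrM -expr2 ler_wpM2r ?sqr_ge0 // hAbB.
  rewrite big_const_seq count_predT iter_addr_0 -[leLHS]mulr_natl ler_wpM2r ?ler_nat //.
  by rewrite !mulr_ge0 // ?sqr_ge0 // ltW.
have kn_gt0 : 0 < k%:R * #|` A|%:R :> R by rewrite mulr_gt0 // ltr0n.
rewrite -(ler_pM2l kn_gt0).
have DEhi := le_trans (_ : #|` D|%:R <= #|` E|%:R) hi.
rewrite ler_nat in DEhi; move: (ler_wpM2l (sqr_ge0 alpha) (DEhi DE)) => hi'.
apply: le_trans (le_trans _ (le_trans lo hi')) _; rewrite le_eqVlt;
  by apply/orP; left; apply/eqP; rewrite -/Q; ring.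
Qed.


(** * Growth of A B^h *)

Theorem theorem1p7 (R : realType) (G : groupType) (A B : {fset G})
    (alpha beta gamma : R)
    (alpha_gt0 : 0 < alpha) (beta_gt0 : 0 < beta) (gamma_gt0 : 0 < gamma)
    (hAB : #|` mulfs A B|%:R <= alpha * #|` A|%:R)
    (hAbB : forall b : G, b \in B ->
       #|` mulfs (mulfs A [fset b]) B|%:R <= beta * #|` A|%:R)
    (hcard : #|` A|%:R <= gamma * #|` B|%:R) :
  exists S : {fset G},
    [/\ S `<=` A,
        (A != fset0 -> S != fset0) &
        forall h : nat, (1 < h)%N ->
          #|` mulfs S (expfs B h)|%:R
            <= alpha ^+ (8 * h - 9) * beta ^+ (h - 1) * gamma ^+ (4 * h - 5)
               * #|` S|%:R].
Proof.
exists A; split=> // h h_gt1.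
have [->|A0] := eqVneq A fset0.
  have -> : mulfs fset0 (expfs B h) = fset0.
    by apply/eqP/fset0Pn => -[z /mulfsP[x]]; rewrite in_fset0.
  by rewrite cardfs0 mulr0.
have n_gt0 : 0 < #|` A|%:R :> R by rewrite ltr0n cardfs_gt0.
have m_gt0 : 0 < #|` B|%:R :> R.
  by have := lt_le_trans n_gt0 hcard; rewrite pmulr_rgt0.
have B0 : B != fset0 by rewrite -cardfs_gt0 -(ltr0n R).
have [k [T [k_gt0 TB Tk cov]]] := exists_coversfs hAB A0 B0.
have tripling := card_mulfs_cover k_gt0 TB Tk cov (ltW beta_gt0) hAbB A0.
(* |B| = |a B| <= |A B| <= alpha |A| <= alpha gamma |B|; inverses turn the left translate a B into a
   right one. *)
have ag_ge1 : 1 <= alpha * gamma.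
  case/fset0Pn: A0 => a aA; rewrite -(ler_pM2r m_gt0) mul1r.
  apply: (@le_trans _ _ #|` mulfs A B|%:R).
    rewrite ler_nat -(card_invfs (mulfs A B)) invfs_mul -(card_invfs B).
    rewrite -(card_mulfs1 (invfs B) (a^-1)%g).
    by apply/fsubset_leq_card/mulfsS; rewrite ?fsub1set ?mem_invfs.
  apply: (le_trans hAB); rewrite -mulrA ler_pM2l //.
(* Triangle inequality through B^-1: |A A^-1| |B| <= |A B|^2. *)
have diff_le : #|` mulfs A (invfs A)|%:R <= alpha ^+ 2 * gamma * #|` A|%:R.
  have := ruzsa_triangle A (invfs B) (invfs A).
  rewrite invfsK -invfs_mul !card_invfs -(ler_nat R) !natrM => diff.
  rewrite -(ler_pM2r m_gt0); apply: le_trans diff _.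
  apply: le_trans (ler_pM _ _ hAB hAB) _ => //.
  have -> : alpha * #|` A|%:R * (alpha * #|` A|%:R)
    = alpha ^+ 2 * #|` A|%:R * #|` A|%:R by ring.
  have -> : alpha ^+ 2 * gamma * #|` A|%:R * #|` B|%:R
    = alpha ^+ 2 * #|` A|%:R * (gamma * #|` B|%:R) by ring.
  by rewrite ler_pM2l // mulr_gt0 // exprn_gt0.
have dbl : #|` mulfs A (mulfs B B)|%:R
    <= alpha ^+ 6 * beta * gamma ^+ 2 * #|` A|%:R.
  rewrite -(ler_pM2r n_gt0); apply: le_trans tripling _.
  have -> : alpha ^+ 6 * beta * gamma ^+ 2 * #|` A|%:R * #|` A|%:R
    = alpha ^+ 2 * beta * (alpha ^+ 2 * gamma * #|` A|%:R) ^+ 2 by ring.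
  by rewrite ler_pM2l ?mulr_gt0 ?exprn_gt0 // lerXn2r ?nnegrE //
    (le_trans (ler0n _ _) diff_le).
(* Triangle inequality through A: |B^-1 B B| |A| <= |A B| |A B B|. *)
have q_le : #|` mulfs (invfs B) (mulfs B B)|%:R
    <= alpha ^+ 7 * beta * gamma ^+ 3 * #|` B|%:R.
  have := ruzsa_triangle (invfs B) A (mulfs B B).
  rewrite -invfs_mul card_invfs -(ler_nat R) !natrM => quot.
  rewrite -(ler_pM2r n_gt0); apply: le_trans quot _.
  apply: le_trans (ler_pM _ _ hAB dbl) _ => //.
  have -> : alpha * #|` A|%:R * (alpha ^+ 6 * beta * gamma ^+ 2 * #|` A|%:R)
    = alpha ^+ 7 * beta * gamma ^+ 2 * #|` A|%:R * #|` A|%:R by ring.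
  have -> : alpha ^+ 7 * beta * gamma ^+ 3 * #|` B|%:R
    = alpha ^+ 7 * beta * gamma ^+ 2 * (gamma * #|` B|%:R) by ring.
  by rewrite ler_pM2r // ler_pM2l // !mulr_gt0 ?exprn_gt0.
(* Triangle inequality through B^-1, with X = A B^(i+1) and Z = B B, so that the ratio is at most
   |B^-1 B B| / |B|. *)
have step i : #|` mulfs A (expfs B i.+3)|%:R
    <= alpha ^+ 7 * beta * gamma ^+ 3 * #|` mulfs A (expfs B i.+2)|%:R.
  have := ruzsa_triangle (mulfs A (expfs B i.+1)) (invfs B) (mulfs B B).
  rewrite invfsK mulfsA -!(mulfsA A) -!expfsSr.
  rewrite card_invfs -(ler_nat R) !natrM => ind.
  rewrite -(ler_pM2r m_gt0); apply: le_trans ind _.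
  by rewrite [leRHS]mulrAC mulrC ler_wpM2r.
case: h h_gt1 => [|[|h]] // _.
(* [dbl] gives the base exponents 6 and 2, each use of [step] adds 7 and 3, and the surplus (alpha
   gamma)^(h+1) >= 1 comes from [ag_ge1]. *)
have -> : (8 * h.+2 - 9 = 6 + 7 * h + h.+1)%N by clear; lia.
have -> : (h.+2 - 1 = h.+1)%N by clear; lia.
have -> : (4 * h.+2 - 5 = 2 + 3 * h + h.+1)%N by clear; lia.
apply: (@le_trans _ _ (alpha ^+ (6 + 7 * h) * beta ^+ h.+1
    * gamma ^+ (2 + 3 * h) * #|` A|%:R)); last first.
  rewrite ler_pM2r // !exprD.
  set u := alpha ^+ 6 * _; set v := gamma ^+ 2 * _.
  have -> : u * alpha ^+ h.+1 * beta ^+ h.+1 * (v * gamma ^+ h.+1)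
    = u * beta ^+ h.+1 * v * (alpha * gamma) ^+ h.+1 by rewrite exprMn; ring.
  by rewrite ler_peMr ?exprn_ege1 // !mulr_ge0 ?exprn_ge0 // ltW.
elim: h => [|h IH]; first by rewrite expfs2 !muln0 !addn0 expr1.
apply: le_trans (step h) _.
have -> : alpha ^+ (6 + 7 * h.+1) * beta ^+ h.+2 * gamma ^+ (2 + 3 * h.+1)
    * #|` A|%:R = alpha ^+ 7 * beta * gamma ^+ 3
    * (alpha ^+ (6 + 7 * h) * beta ^+ h.+1 * gamma ^+ (2 + 3 * h) * #|` A|%:R).
  rewrite [beta ^+ h.+2]exprS !mulnS !exprD; ring.
by rewrite ler_pM2l // !mulr_gt0 ?exprn_gt0.
Qed.
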